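(* For each integer $c\ge 1$ there exists a polynomial $P$ (depending only on $c$) such that the following holds. Let $r\ge 1$, let $N_{r,c}$ be the free nilpotent group of rank $r$ and class $c$ with free generators $x_1,\dots,x_r$, let $y_1,\dots,y_m$ be any Malcev basis of iterated commutators for $N_{r,c}$, and let $w$ be any group word in $x_1^{\pm1},\dots,x_r^{\pm1}$. Then there are integers $\alpha_1,\dots,\alpha_m$ such that $$w=y_1^{\alpha_1}\cdots y_m^{\alpha_m}$$ in $N_{r,c}$ and $|\alpha_i|\le P(|w|)$ for all $i=1,\dots,m$, where $|w|$ is the length of the word $w$.
   Context: A Malcev basis of iterated commutators for $N_{r,c}$ is defined as follows. Put $y_{11}=x_1,\dots,y_{1r}=x_r$. For $2\le i\le c$, let $y_{i1},\dots,y_{ij_i}$ be left-normed iterated commutators $[\dots[x_{a_1}^{\pm1},x_{a_2}^{\pm1}],\dots,x_{a_i}^{\pm1}]^{\pm1}$ of weight $i$ in the generators whose images form a basis of the free abelian group $\gamma_i(N_{r,c})/\gamma_{i+1}(N_{r,c})$, where $\gamma_i$ denotes the $i$th term of the lower central series. The list $y_{11},\dots,y_{1r},y_{21},\dots,y_{cj_c}$ is renamed $y_1,\dots,y_m$, ordered by weight (so $y_1=x_1,\dots,y_r=x_r$). *)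

(* Defs.v *)
(* Free nilpotent groups are encoded via group terms and
   equality in N_{r,c} is defined by the universal property: two terms are
   equal in N_{r,c} iff they agree in every group of nilpotency class <= c
   under every assignment of the generators. *)
From Stdlib Require Import ZArith List Arith.
Import ListNotations.
Open Scope Z_scope.

Record Group := {
  gcar :> Type;
  gop : gcar -> gcar -> gcar;
  gunit : gcar;
  ginvG : gcar -> gcar;
  gassoc : forall x y z, gop x (gop y z) = gop (gop x y) z;
  gid_l : forall x, gop gunit x = x;
  ginv_l : forall x, gop (ginvG x) x = gunit }.

Definition commG (G : Group) (a b : G) : G :=
  gop G (gop G (ginvG G a) (ginvG G b)) (gop G a b).

Definition lcommG (G : Group) (a : G) (l : list G) : G :=
  fold_left (commG G) l a.

Definition nilpotent_le (G : Group) (c : nat) : Prop :=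
  forall (a : G) (l : list G), length l = c -> lcommG G a l = gunit G.

Inductive gterm : Type :=
| gvar (i : nat)
| gone
| gmul (a b : gterm)
| ginv (a : gterm).

Fixpoint eval (G : Group) (f : nat -> G) (t : gterm) : G :=
  match t with
  | gvar i => f i
  | gone => gunit G
  | gmul a b => gop G (eval G f a) (eval G f b)
  | ginv a => ginvG G (eval G f a)
  end.

Fixpoint scoped (r : nat) (t : gterm) : Prop :=
  match t with
  | gvar i => (i < r)%nat
  | gone => True
  | gmul a b => scoped r a /\ scoped r b
  | ginv a => scoped r a
  end.

Definition Neq (c : nat) (t1 t2 : gterm) : Prop :=
  forall (G : Group), nilpotent_le G c ->
  forall f : nat -> G, eval G f t1 = eval G f t2.

Definition tcomm (a b : gterm) : gterm :=
  gmul (gmul (ginv a) (ginv b)) (gmul a b).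

Definition tlcomm (a : gterm) (l : list gterm) : gterm := fold_left tcomm l a.

Fixpoint tpowN (t : gterm) (n : nat) : gterm :=
  match n with O => gone | S n => gmul t (tpowN t n) end.

Definition tpow (t : gterm) (z : Z) : gterm :=
  if (0 <=? z) then tpowN t (Z.to_nat z) else ginv (tpowN t (Z.to_nat (- z))).

Definition prod_pow (ts : list gterm) (es : list Z) : gterm :=
  fold_right (fun p acc => gmul (tpow (fst p) (snd p)) acc) gone (combine ts es).

Definition letter := (nat * bool)%type.
Definition letter_term (l : letter) : gterm :=
  if snd l then gvar (fst l) else ginv (gvar (fst l)).
Definition word_term (w : list letter) : gterm :=
  fold_right (fun l acc => gmul (letter_term l) acc) gone w.
Definition word_in (r : nat) (w : list letter) : Prop :=
  Forall (fun l => (fst l < r)%nat) w.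

Inductive in_gamma (r c : nat) : nat -> gterm -> Prop :=
| gam_base t : scoped r t -> in_gamma r c 1 t
| gam_comm i a b : in_gamma r c i a -> scoped r b -> in_gamma r c (S i) (tcomm a b)
| gam_one i : in_gamma r c i gone
| gam_mul i a b : in_gamma r c i a -> in_gamma r c i b -> in_gamma r c i (gmul a b)
| gam_inv i a : in_gamma r c i a -> in_gamma r c i (ginv a)
| gam_eq i a b : in_gamma r c i a -> scoped r b -> Neq c a b -> in_gamma r c i b.

(* a specification (letters, s) of the commutator
   [...[x_{a1}^{±1}, x_{a2}^{±1}], ..., x_{ai}^{±1}]^{±1}, outer sign s *)
Definition comm_spec := (list letter * bool)%type.

Definition spec_term (s : comm_spec) : gterm :=
  match fst s with
  | [] => gone
  | l :: ls =>
      let t := tlcomm (letter_term l) (map letter_term ls) in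
      if snd s then t else ginv t
  end.

Definition spec_ok (r i : nat) (s : comm_spec) : Prop :=
  length (fst s) = i /\ word_in r (fst s).

(* the terms B (in N_{r,c}, all in gamma_i) have images forming a basis of
   the free abelian group gamma_i / gamma_{i+1} *)
Definition basis_mod (r c i : nat) (B : list gterm) : Prop :=
  (forall t, in_gamma r c i t ->
     exists es : list Z, length es = length B /\
       in_gamma r c (S i) (gmul (ginv (prod_pow B es)) t)) /\
  (forall es : list Z, length es = length B ->
     in_gamma r c (S i) (prod_pow B es) -> Forall (fun e => e = 0) es).

(* Y = [block of weight 1; block of weight 2; ...; block of weight c];
   the Malcev basis y_1, ..., y_m is concat Y *)
Definition MalcevBasis (r c : nat) (Y : list (list comm_spec)) : Prop :=
  length Y = c /\
  nth 0 Y [] = map (fun k => ([(k, true)], true)) (seq 0 r) /\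
  forall i, (2 <= i <= c)%nat ->
    Forall (spec_ok r i) (nth (i - 1) Y []) /\
    basis_mod r c i (map spec_term (nth (i - 1) Y [])).

Definition malcev_terms (Y : list (list comm_spec)) : list gterm :=
  map spec_term (concat Y).

Definition peval (p : list Z) (x : Z) : Z :=
  fold_right (fun a acc => a + x * acc) 0 p.

(* Main.v *)
(* Up to equality in all groups of class at most [c], words are handled as lists of
   signed left-normed commutators, and the weight-1 part, then the weight-2 part, and
   so on are collected to the left. Moving a commutator across another one creates
   only heavier commutators, boundedly many of them, so each of the [c] rounds
   increases the length polynomially.

   Two facts make the bound independent of the rank and of the basis. A commutator
   [[u, s]] involves at most [2c] generators, so up to renaming there are finitely
   many cases. When [u] of weight [i] is expressed modulo [gamma_{i+1}] through the
   basis, killing the generators that do not occur in [u] fixes [u], fixes the basis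
   elements supported on the generators of [u], and erases all the others; again only
   finitely many configurations remain up to renaming. *)
Require Import Defs.
From Stdlib Require Import ZArith List Arith.
From Stdlib Require Import Lia Classical Morphisms Setoid.
Import ListNotations.
Local Open Scope nat_scope.

(** * Group identities and left-normed commutators *)

Section GroupFacts.
Variable G : Group.
Local Notation "x * y" := (gop G x y).
Local Notation "x ^-" := (ginvG G x) (at level 9).
Local Notation e := (gunit G).

Lemma gcancel (a x y : G) : a * x = a * y -> x = y.
Proof.
  intros H. rewrite <- (gid_l G x), <- (gid_l G y), <- (ginv_l G a).
  now rewrite <- !gassoc, H.
Qed.

Lemma ginv_r (x : G) : x * x^- = e.
Proof.
  apply (gcancel x^-). rewrite gassoc, ginv_l, gid_l.
  apply (gcancel x^-^-). now rewrite gassoc, !ginv_l, gid_l.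
Qed.

Lemma gid_r (x : G) : x * e = x.
Proof. now rewrite <- (ginv_l G x), gassoc, ginv_r, gid_l. Qed.

Lemma ginv_mulK (x y : G) : x^- * (x * y) = y.
Proof. now rewrite gassoc, ginv_l, gid_l. Qed.

Lemma gmul_invK (x y : G) : x * (x^- * y) = y.
Proof. now rewrite gassoc, ginv_r, gid_l. Qed.

Lemma ginv_inv (x : G) : x^-^- = x.
Proof. apply (gcancel x^-). now rewrite ginv_r, ginv_l. Qed.

Lemma ginv_mul (x y : G) : (x * y)^- = y^- * x^-.
Proof.
  apply (gcancel (x * y)).
  now rewrite ginv_r, <- gassoc, gmul_invK, ginv_r.
Qed.

Lemma ginv_unit : e^- = e.
Proof. now rewrite <- (gid_l G e^-), ginv_r. Qed.
End GroupFacts.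

#[local] Hint Rewrite gid_l gid_r ginv_l ginv_r ginv_mulK gmul_invK ginv_inv
  ginv_mul ginv_unit : grp.
#[local] Hint Rewrite <- gassoc : grp.
Ltac group := unfold commG; autorewrite with grp; try reflexivity.

Section Commutators.
Variable G : Group.

Lemma commG_unit_l (a : G) : commG G (gunit G) a = gunit G.
Proof. group. Qed.

Lemma commG_unit_r (a : G) : commG G a (gunit G) = gunit G.
Proof. group. Qed.

Lemma lcommG_unit (l : list G) : lcommG G (gunit G) l = gunit G.
Proof.
  induction l as [|a l IH]; [reflexivity|].
  unfold lcommG in *; simpl. now rewrite commG_unit_l.
Qed.

Lemma lcommG_unit_in (l : list G) (a : G) :
  In (gunit G) l -> lcommG G a l = gunit G.
Proof.
  revert a; induction l as [|b l IH]; intros a; [intros []|intros [H|H]];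
    unfold lcommG in *; simpl.
  - subst. rewrite commG_unit_r. apply lcommG_unit.
  - now apply IH.
Qed.

(** The surplus initial entries are absorbed into the base of the commutator, which leaves exactly
    [c] entries as [nilpotent_le] demands. *)
Lemma lcommG_long (c : nat) (a : G) (l : list G) :
  nilpotent_le G c -> c <= length l -> lcommG G a l = gunit G.
Proof.
  intros HG Hl.
  rewrite <- (firstn_skipn (length l - c) l).
  unfold lcommG; rewrite fold_left_app. apply HG.
  rewrite length_skipn. lia.
Qed.
End Commutators.

Lemma eval_tlcomm (G : Group) (f : nat -> G) (a : gterm) (l : list gterm) :
  eval G f (tlcomm a l) = lcommG G (eval G f a) (map (eval G f) l).
Proof.
  revert a; induction l as [|b l IH]; intros a; [reflexivity|].
  unfold tlcomm, lcommG in *; simpl. now rewrite IH.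
Qed.

Lemma eval_tcomm (G : Group) (f : nat -> G) (a b : gterm) :
  eval G f (tcomm a b) = commG G (eval G f a) (eval G f b).
Proof. reflexivity. Qed.

(** * Products of signed left-normed commutators *)

Definition weight (s : comm_spec) : nat := length (fst s).

Definition flip (s : comm_spec) : comm_spec := (fst s, negb (snd s)).

Lemma flip_flip (s : comm_spec) : flip (flip s) = s.
Proof. destruct s as [l []]; reflexivity. Qed.

Definition spec_val (G : Group) (f : nat -> G) (s : comm_spec) : G :=
  eval G f (spec_term s).

Fixpoint spec_prod (G : Group) (f : nat -> G) (L : list comm_spec) : G :=
  match L with [] => gunit G | s :: L => gop G (spec_val G f s) (spec_prod G f L) end.

Arguments spec_val : simpl never.

Definition equiv (c : nat) (L1 L2 : list comm_spec) : Prop :=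
  forall G : Group, nilpotent_le G c ->
  forall f : nat -> G, spec_prod G f L1 = spec_prod G f L2.

Lemma spec_val_flip (G : Group) (f : nat -> G) (s : comm_spec) :
  spec_val G f (flip s) = ginvG G (spec_val G f s).
Proof.
  destruct s as [[|l ls] []]; unfold spec_val; cbn; group.
Qed.

Lemma spec_val_heavy (c : nat) (G : Group) (f : nat -> G) (s : comm_spec) :
  nilpotent_le G c -> c < weight s -> spec_val G f s = gunit G.
Proof.
  intros HG. destruct s as [[|l ls] b]; unfold spec_val, weight; cbn; [lia|].
  intros Hc.
  assert (E : eval G f (tlcomm (letter_term l) (map letter_term ls)) = gunit G).
  { rewrite eval_tlcomm. apply (lcommG_long G c); [assumption|].
    rewrite !length_map. lia. }
  destruct b; cbn; rewrite E; group.
Qed.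

Lemma spec_prod_app (G : Group) (f : nat -> G) (L1 L2 : list comm_spec) :
  spec_prod G f (L1 ++ L2) = gop G (spec_prod G f L1) (spec_prod G f L2).
Proof.
  induction L1 as [|s L IH]; cbn; [group|]. rewrite IH; group.
Qed.

Lemma spec_prod_inv (G : Group) (f : nat -> G) (L : list comm_spec) :
  spec_prod G f (rev (map flip L)) = ginvG G (spec_prod G f L).
Proof.
  induction L as [|s L IH]; cbn; [group|].
  rewrite spec_prod_app, IH. cbn. rewrite spec_val_flip. group.
Qed.

Fixpoint prod_term (M : list comm_spec) : gterm :=
  match M with [] => gone | s :: M => gmul (spec_term s) (prod_term M) end.

Lemma eval_prod_term (G : Group) (f : nat -> G) (M : list comm_spec) :
  eval G f (prod_term M) = spec_prod G f M.
Proof. induction M as [|s M IH]; cbn; [reflexivity|]. now rewrite <- IH. Qed.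

#[local] Instance equiv_Equivalence (c : nat) : Equivalence (equiv c).
Proof.
  split.
  - intros x G HG f. reflexivity.
  - intros x y H G HG f. symmetry. now apply H.
  - intros x y z H H' G HG f. rewrite (H G HG f). now apply H'.
Qed.

#[local] Instance app_equiv (c : nat) :
  Proper (equiv c ==> equiv c ==> equiv c) (@app comm_spec).
Proof.
  intros a a' Ha b b' Hb G HG f. rewrite !spec_prod_app, (Ha G HG f), (Hb G HG f).
  reflexivity.
Qed.

#[local] Instance cons_equiv (c : nat) :
  Proper (eq ==> equiv c ==> equiv c) (@cons comm_spec).
Proof.
  intros a a' <- b b' Hb G HG f. cbn. now rewrite (Hb G HG f).
Qed.

(** Heavier commutators vanish in class at most [c], so the cap [c] costs nothing; it keeps the
    specs on boundedly many generators finite in number. *)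
Definition admissible (c r k : nat) (s : comm_spec) : Prop :=
  k <= weight s <= c /\ word_in r (fst s).

Lemma admissible_le (c r k k' : nat) (s : comm_spec) :
  k' <= k -> admissible c r k s -> admissible c r k' s.
Proof. unfold admissible; intuition lia. Qed.

Lemma Forall_admissible_le (c r k k' : nat) (L : list comm_spec) :
  k' <= k -> Forall (admissible c r k) L -> Forall (admissible c r k') L.
Proof. intros H. apply Forall_impl. intros s. now apply admissible_le. Qed.

(** * The lower central series is generated by left-normed commutators *)

Definition generated (c r k : nat) (t : gterm) : Prop :=
  exists M, Forall (admissible c r k) M /\
    forall G : Group, nilpotent_le G c ->
    forall f : nat -> G, eval G f t = spec_prod G f M.

Section Generated.
Variables c r : nat.

Lemma generated_eq (k : nat) (t t' : gterm) :
  generated c r k t -> Neq c t t' -> generated c r k t'.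
Proof.
  intros (M & HM & E) H. exists M; split; [assumption|].
  intros G HG f. rewrite <- E by assumption. symmetry. now apply H.
Qed.

Lemma generated_one (k : nat) : generated c r k gone.
Proof. now exists []. Qed.

Lemma generated_mul (k : nat) (a b : gterm) :
  generated c r k a -> generated c r k b -> generated c r k (gmul a b).
Proof.
  intros (M & HM & E) (M' & HM' & E'). exists (M ++ M'); split.
  - now apply Forall_app.
  - intros G HG f. cbn. now rewrite spec_prod_app, E, E'.
Qed.

Lemma generated_inv (k : nat) (a : gterm) :
  generated c r k a -> generated c r k (ginv a).
Proof.
  intros (M & HM & E). exists (rev (map flip M)); split.
  - apply Forall_rev, Forall_map. revert HM. now apply Forall_impl.
  - intros G HG f. cbn. now rewrite spec_prod_inv, E.
Qed.

(** A spec heavier than [c] is not admissible but trivial, and the empty product represents it. *)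
Lemma generated_spec (k : nat) (s : comm_spec) :
  k <= weight s -> word_in r (fst s) -> generated c r k (spec_term s).
Proof.
  intros Hk Hs. destruct (le_lt_dec (weight s) c) as [Hc|Hc].
  - exists [s]; split.
    + repeat constructor; auto.
    + intros G HG f. cbn. now rewrite gid_r.
  - exists []; split; [constructor|].
    intros G HG f. now apply (spec_val_heavy c).
Qed.

Definition tconj (t b : gterm) : gterm := gmul (ginv b) (gmul t b).

Lemma spec_term_comm_letter (l : letter) (ls : list letter) (x : letter) :
  spec_term ((l :: ls) ++ [x], true) =
  tcomm (spec_term (l :: ls, true)) (letter_term x).
Proof.
  cbn. unfold tlcomm. now rewrite map_app, fold_left_app.
Qed.

Lemma word_in_app (w w' : list letter) :
  word_in r w -> word_in r w' -> word_in r (w ++ w').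
Proof. intros; apply Forall_app; auto. Qed.

Lemma generated_spec_comm_letter (k : nat) (s : list letter) (x : letter) :
  1 <= k -> k <= length s -> word_in r s -> fst x < r ->
  generated c r (S k) (tcomm (spec_term (s, true)) (letter_term x)).
Proof.
  intros Hk Hs Hr Hx. destruct s as [|l ls]; [cbn in Hs; lia|].
  rewrite <- spec_term_comm_letter. apply generated_spec.
  - unfold weight; cbn in *. rewrite length_app; cbn. lia.
  - apply word_in_app; [assumption|]. repeat constructor; assumption.
Qed.

Lemma spec_term_flip (s : comm_spec) : Neq c (ginv (spec_term s)) (spec_term (flip s)).
Proof. intros G HG f. symmetry. apply spec_val_flip. Qed.

Lemma generated_weaken (k k' : nat) (t : gterm) :
  k' <= k -> generated c r k t -> generated c r k' t.
Proof.
  intros H (M & HM & E). exists M; split; [|assumption].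
  now apply (Forall_admissible_le c r k).
Qed.

(** Since [t^x = t [t, x]], conjugation by a letter only adds a commutator of higher weight; a
    negative outer sign is handled by inverting. *)
Lemma generated_spec_conj_letter (k : nat) (s : comm_spec) (x : letter) :
  1 <= k -> admissible c r k s -> fst x < r ->
  generated c r k (tconj (spec_term s) (letter_term x)).
Proof.
  intros Hk [[Hs _] Hr] Hx. destruct s as [s b]; unfold weight in Hs; cbn in *.
  assert (H : generated c r k (tconj (spec_term (s, true)) (letter_term x))).
  { eapply generated_eq;
      [apply (generated_mul k (spec_term (s, true))
                (tcomm (spec_term (s, true)) (letter_term x)))|].
    - now apply generated_spec.
    - apply (generated_weaken (S k)); [lia|]. now apply generated_spec_comm_letter.
    - intros G HG f. cbn. group. }
  destruct b; [assumption|].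
  eapply generated_eq; [apply generated_inv, H|].
  intros G HG f.
  pose proof (spec_term_flip (s, true) G HG f) as E. unfold flip in E; cbn in *.
  rewrite <- E. group.
Qed.

(** Induction along the product that witnesses [generated]. Closure of [P] under [Neq] is required
    because [t] is only equal to that product in class at most [c]. *)
Lemma generated_ind (k : nat) (P : gterm -> Prop) :
  (forall s, admissible c r k s -> P (spec_term s)) ->
  P gone ->
  (forall s b, admissible c r k s -> generated c r k b -> P (spec_term s) -> P b ->
     P (gmul (spec_term s) b)) ->
  (forall a b, P a -> Neq c a b -> P b) ->
  forall t, generated c r k t -> P t.
Proof.
  intros Hs H1 Hm He t (M & HM & E).
  apply (He (prod_term M)).
  - clear E. induction HM as [|s M Hsm HM IH]; [assumption|].
    apply Hm; auto. exists M. split; [assumption|].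
    intros G _ f. apply eval_prod_term.
  - intros G HG f. now rewrite eval_prod_term, E.
Qed.

Lemma generated_conj_letter (k : nat) (x : letter) (t : gterm) :
  1 <= k -> fst x < r -> generated c r k t ->
  generated c r k (tconj t (letter_term x)).
Proof.
  intros Hk Hx. revert t.
  apply (generated_ind k (fun t => generated c r k (tconj t (letter_term x)))).
  - intros s Hs. now apply generated_spec_conj_letter.
  - eapply generated_eq; [apply generated_one|]. intros G HG f; cbn; group.
  - intros s b _ _ Ha Hb. eapply generated_eq; [apply generated_mul; [apply Ha|apply Hb]|].
    intros G HG f; cbn; group.
  - intros a b Ha E. eapply generated_eq; [apply Ha|].
    intros G HG f; cbn. now rewrite (E G HG f).
Qed.

(** Conjugation by [b] and by its inverse are treated together, because the case [ginv] exchanges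
    them. *)
Lemma generated_conj (k : nat) (b : gterm) :
  1 <= k -> scoped r b -> forall t, generated c r k t ->
  generated c r k (tconj t b) /\ generated c r k (tconj t (ginv b)).
Proof.
  intros Hk. induction b as [i| |a IHa b IHb|a IHa]; cbn; intros Hb t Ht.
  - split.
    + now apply (generated_conj_letter k (i, true)).
    + now apply (generated_conj_letter k (i, false)).
  - split; (eapply generated_eq; [apply Ht|]); intros G HG f; cbn; group.
  - destruct Hb as [Ha Hb]. split.
    + eapply generated_eq; [apply (proj1 (IHb Hb _ (proj1 (IHa Ha _ Ht))))|].
      intros G HG f; cbn; group.
    + eapply generated_eq; [apply (proj2 (IHa Ha _ (proj2 (IHb Hb _ Ht))))|].
      intros G HG f; cbn; group.
  - split.
    + now apply IHa.
    + eapply generated_eq; [apply (proj1 (IHa Hb _ Ht))|]. intros G HG f; cbn; group.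
Qed.

Lemma scoped_letter (x : letter) : fst x < r -> scoped r (letter_term x).
Proof. now destruct x as [i []]. Qed.

Lemma scoped_tlcomm (l : list letter) (a : gterm) :
  scoped r a -> word_in r l -> scoped r (tlcomm a (map letter_term l)).
Proof.
  intros Ha Hl; revert a Ha.
  induction Hl as [|x l Hx Hl IH]; intros a Ha; [assumption|].
  unfold tlcomm in *; cbn. apply IH. cbn.
  pose proof (scoped_letter x Hx). tauto.
Qed.

Lemma scoped_spec (s : comm_spec) : word_in r (fst s) -> scoped r (spec_term s).
Proof.
  destruct s as [[|l ls] b]; cbn; [trivial|]. intros H; inversion_clear H.
  assert (scoped r (tlcomm (letter_term l) (map letter_term ls))).
  { apply scoped_tlcomm; [now apply scoped_letter|assumption]. }
  now destruct b.
Qed.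

Lemma generated_comm_letter (k : nat) (x : letter) (t : gterm) :
  1 <= k -> fst x < r -> generated c r k t ->
  generated c r (S k) (tcomm t (letter_term x)).
Proof.
  intros Hk Hx. revert t.
  apply (generated_ind k (fun t => generated c r (S k) (tcomm t (letter_term x)))).
  - intros [s b] [[Hs _] Hr]. unfold weight in Hs; cbn in Hs, Hr.
    pose proof (generated_spec_comm_letter k s x Hk Hs Hr Hx) as H.
    destruct b; [assumption|].
    (* For a negative outer sign, [[s^-1, x] = s [s, x]^-1 s^-1], a conjugate of an element already
       generated. *)
    eapply generated_eq.
    + refine (proj2 (generated_conj (S k) (spec_term (s, true)) _ _ _ (generated_inv _ _ H)));
        [lia|now apply scoped_spec].
    + intros G HG f.
      pose proof (spec_term_flip (s, true) G HG f) as E. unfold flip in E; cbn in *.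
      rewrite <- E. group.
  - eapply generated_eq; [apply generated_one|]. intros G HG f; cbn; group.
  - intros s b Hs (M & HM & E) Ha Hb.
    (* [[ab, x] = [a, x]^b [b, x]], and [b] is a product of specs, hence scoped. *)
    assert (ST : scoped r (prod_term M)).
    { clear - HM. induction HM as [|s' M [_ Hs'] _ IH]; cbn; [trivial|].
      split; [now apply scoped_spec|assumption]. }
    eapply generated_eq.
    + refine (generated_mul _ _ _ (proj1 (generated_conj (S k) (prod_term M) _ ST _ Ha)) Hb). lia.
    + intros G HG f; cbn. rewrite eval_prod_term, E by assumption. group.
  - intros a b Ha E. eapply generated_eq; [apply Ha|].
    intros G HG f; cbn. now rewrite (E G HG f).
Qed.

(** Induction on [b] reduces to letters through [[t, ab] = [t, b] [t, a]^b] and [[t, a^-1] = a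
    [t, a]^-1 a^-1]. *)
Lemma generated_comm (k : nat) (t b : gterm) :
  1 <= k -> generated c r k t -> scoped r b -> generated c r (S k) (tcomm t b).
Proof.
  intros Hk Ht. induction b as [i| |a IHa b IHb|a IHa]; cbn; intros Hb.
  - now apply (generated_comm_letter k (i, true)).
  - eapply generated_eq; [apply generated_one|]. intros G HG f; cbn; group.
  - destruct Hb as [Ha Hb]. eapply generated_eq.
    + refine (generated_mul _ _ _ (IHb Hb) (proj1 (generated_conj (S k) b _ Hb _ (IHa Ha)))).
      lia.
    + intros G HG f; cbn; group.
  - eapply generated_eq.
    + refine (proj2 (generated_conj (S k) a _ Hb _ (generated_inv _ _ (IHa Hb)))). lia.
    + intros G HG f; cbn; group.
Qed.

Lemma generated_scoped (t : gterm) : scoped r t -> generated c r 1 t.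
Proof.
  induction t as [i| |a IHa b IHb|a IHa]; cbn; intros H.
  - apply (generated_spec 1 ([(i, true)], true)); [cbn; lia|].
    repeat constructor; assumption.
  - apply generated_one.
  - apply generated_mul; tauto.
  - apply generated_inv; tauto.
Qed.

(* [in_gamma] also has a junk index [0], where only the trivial element lives. *)
Lemma in_gamma_0 (k : nat) (t : gterm) : in_gamma r c k t -> k = 0 -> Neq c t gone.
Proof.
  induction 1 as [t Ht|k a b Ha IH Hb|k|k a b Ha IHa Hb IHb|k a Ha IH|k a b Ha IH Hb E];
    intros Hk; try discriminate; intros G HG f; cbn.
  - reflexivity.
  - rewrite (IHa Hk G HG f), (IHb Hk G HG f). cbn; group.
  - rewrite (IH Hk G HG f). cbn; group.
  - rewrite <- (E G HG f). apply (IH Hk G HG f).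
Qed.

(** This turns membership in the lower central series, and so any congruence modulo its next term,
    into an explicit list of heavier commutators. *)
Lemma generated_gamma (k : nat) (t : gterm) :
  1 <= k -> in_gamma r c k t -> generated c r k t.
Proof.
  intros Hk H; revert Hk.
  induction H as [t Ht|k a b Ha IH Hb|k|k a b Ha IHa Hb IHb|k a Ha IH|k a b Ha IH Hb E];
    intros Hk.
  - now apply generated_scoped.
  - destruct k as [|k].
    + eapply generated_eq; [apply generated_one|]. intros G HG f.
      rewrite eval_tcomm, (in_gamma_0 0 a Ha eq_refl G HG f). symmetry.
      apply commG_unit_l.
    + apply generated_comm; [lia|apply IH; lia|assumption].
  - apply generated_one.
  - apply generated_mul; auto.
  - apply generated_inv; auto.
  - eapply generated_eq; [apply IH|]; auto.
Qed.
End Generated.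

(** * Uniform bounds by renaming generators *)

Definition rename (rho : nat -> nat) (s : comm_spec) : comm_spec :=
  (map (fun l => (rho (fst l), snd l)) (fst s), snd s).

Lemma weight_rename (rho : nat -> nat) (s : comm_spec) :
  weight (rename rho s) = weight s.
Proof. apply length_map. Qed.

Lemma rename_rename (rho rho' : nat -> nat) (s : comm_spec) :
  rename rho (rename rho' s) = rename (fun k => rho (rho' k)) s.
Proof. destruct s as [w b]; unfold rename; cbn. now rewrite map_map. Qed.

Definition letter_val (G : Group) (f : nat -> G) (l : letter) : G :=
  eval G f (letter_term l).

(** A commutator sees the assignment only through the values of its letters. Both renaming and
    erasing generators rest on this. *)
Lemma spec_val_letters (G : Group) (f : nat -> G) (f' : nat -> G) (s s' : comm_spec) :
  map (letter_val G f) (fst s) = map (letter_val G f') (fst s') -> snd s = snd s' ->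
  spec_val G f s = spec_val G f' s'.
Proof.
  destruct s as [[|l ls] b], s' as [[|l' ls'] b']; cbn; intros H E;
    try discriminate; [reflexivity|].
  injection H as Hl Hls. subst b'. unfold spec_val; cbn.
  assert (eval G f (tlcomm (letter_term l) (map letter_term ls)) =
          eval G f' (tlcomm (letter_term l') (map letter_term ls'))) as E.
  { rewrite !eval_tlcomm, !map_map. unfold letter_val in *. now rewrite Hl, Hls. }
  destruct b; cbn; now rewrite E.
Qed.

Lemma spec_val_rename (G : Group) (f : nat -> G) (rho : nat -> nat) (s : comm_spec) :
  spec_val G f (rename rho s) = spec_val G (fun k => f (rho k)) s.
Proof.
  apply spec_val_letters; [|reflexivity]. cbn. rewrite map_map.
  apply map_ext. now intros [k []].
Qed.

Lemma spec_val_kill (G : Group) (f : nat -> G) (s : comm_spec) (l : letter) :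
  In l (fst s) -> f (fst l) = gunit G -> spec_val G f s = gunit G.
Proof.
  destruct s as [[|l0 ls] b]; cbn; [tauto|]. intros Hl Hf.
  assert (E : eval G f (letter_term l) = gunit G).
  { destruct l as [k []]; cbn in *; rewrite Hf; group. }
  assert (E' : eval G f (tlcomm (letter_term l0) (map letter_term ls)) = gunit G).
  { rewrite eval_tlcomm. destruct Hl as [->|Hl].
    - rewrite E. apply lcommG_unit.
    - apply lcommG_unit_in. rewrite map_map, <- E.
      now apply (in_map (fun x => eval G f (letter_term x))). }
  unfold spec_val; destruct b; cbn; rewrite E'; group.
Qed.

Lemma equiv_rename (c : nat) (rho : nat -> nat) (L1 L2 : list comm_spec) :
  equiv c L1 L2 -> equiv c (map (rename rho) L1) (map (rename rho) L2).
Proof.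
  intros H G HG f.
  assert (E : forall L, spec_prod G f (map (rename rho) L) =
                        spec_prod G (fun k => f (rho k)) L).
  { induction L as [|s L IH]; cbn; [reflexivity|]. now rewrite spec_val_rename, IH. }
  rewrite !E. now apply H.
Qed.

(** The lists [vs] used below may contain repetitions; the first occurrence serves as the new name
    of a generator. *)
Fixpoint index (vs : list nat) (k : nat) : nat :=
  match vs with [] => 0 | v :: vs => if k =? v then 0 else S (index vs k) end.

Lemma index_lt (vs : list nat) (k : nat) : In k vs -> index vs k < length vs.
Proof.
  induction vs as [|v vs IH]; cbn; [tauto|]. intros H.
  destruct (Nat.eqb_spec k v); [lia|].
  destruct H as [H|H]; [congruence|]. specialize (IH H); lia.
Qed.

Lemma nth_index (vs : list nat) (k : nat) : In k vs -> nth (index vs k) vs 0 = k.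
Proof.
  induction vs as [|v vs IH]; cbn; [tauto|]. intros H.
  destruct (Nat.eqb_spec k v); [congruence|].
  destruct H as [H|H]; [congruence|]. now apply IH.
Qed.

Definition mem (vs : list nat) (k : nat) : bool := existsb (Nat.eqb k) vs.

Lemma mem_In (vs : list nat) (k : nat) : mem vs k = true <-> In k vs.
Proof.
  unfold mem. rewrite existsb_exists. split.
  - intros (x & Hx & E). apply Nat.eqb_eq in E. now subst.
  - intros H. exists k. split; [assumption|apply Nat.eqb_refl].
Qed.

Definition supported (vs : list nat) (s : comm_spec) : bool :=
  forallb (fun l => mem vs (fst l)) (fst s).

Lemma supported_In (vs : list nat) (s : comm_spec) :
  supported vs s = true <-> forall l, In l (fst s) -> In (fst l) vs.
Proof.
  unfold supported. rewrite forallb_forall.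
  split; intros H l Hl; apply mem_In; auto.
Qed.

Definition compress (vs : list nat) (s : comm_spec) : comm_spec := rename (index vs) s.

Definition expand_spec (vs : list nat) (s : comm_spec) : comm_spec :=
  rename (fun k => nth k vs 0) s.

Lemma expand_compress (vs : list nat) (s : comm_spec) :
  supported vs s = true -> expand_spec vs (compress vs s) = s.
Proof.
  intros H. unfold expand_spec, compress. rewrite rename_rename.
  destruct s as [w b]; unfold rename; cbn. f_equal.
  erewrite map_ext_in; [apply map_id|]. intros [k d] Hk; cbn. f_equal.
  apply nth_index. exact (proj1 (supported_In vs _) H _ Hk).
Qed.

(* Compression is induced by the homomorphism that sends the generators outside
   [vs] to the identity; it erases the commutators not supported on [vs]. *)
Lemma equiv_compress (c : nat) (vs : list nat) (L1 L2 : list comm_spec) :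
  equiv c L1 L2 ->
  equiv c (map (compress vs) (filter (supported vs) L1))
          (map (compress vs) (filter (supported vs) L2)).
Proof.
  intros H G HG g.
  set (f := fun k => if mem vs k then g (index vs k) else gunit G).
  assert (E : forall L, spec_prod G g (map (compress vs) (filter (supported vs) L)) =
                        spec_prod G f L).
  { induction L as [|s L IH]; cbn; [reflexivity|].
    destruct (supported vs s) eqn:Hs; cbn; rewrite IH.
    - f_equal. unfold compress. rewrite spec_val_rename.
      apply (spec_val_letters G); [|reflexivity]. apply map_ext_in. intros [k d] Hl.
      assert (Hk : mem vs k = true).
      { apply mem_In. exact (proj1 (supported_In vs s) Hs _ Hl). }
      unfold letter_val, f; destruct d; cbn; now rewrite Hk.
    - assert (exists l, In l (fst s) /\ mem vs (fst l) = false) as (l & Hl & Hm).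
      { clear -Hs. unfold supported in Hs. induction (fst s) as [|l w IHw]; cbn in Hs; [discriminate|].
        destruct (mem vs (fst l)) eqn:E.
        - destruct IHw as (l' & ? & ?); [exact Hs|]. exists l'; cbn; auto.
        - exists l; cbn; auto. }
      rewrite (spec_val_kill G f s l Hl); [group|]. unfold f. now rewrite Hm. }
  rewrite !E. now apply H.
Qed.

Fixpoint words (m n : nat) : list (list letter) :=
  match n with
  | 0 => [[]]
  | S n => map (fun p => fst p :: snd p)
             (list_prod (list_prod (seq 0 m) [true; false]) (words m n))
  end.

Lemma in_words (m : nat) (w : list letter) : word_in m w -> In w (words m (length w)).
Proof.
  induction 1 as [|[k d] w Hk Hw IH]; cbn -[list_prod]; [auto|].
  apply in_map_iff. exists ((k, d), w). split; [reflexivity|].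
  apply in_prod; [|assumption]. apply in_prod.
  - apply in_seq. cbn in Hk; lia.
  - destruct d; cbn; auto.
Qed.

Definition specs (m c : nat) : list comm_spec :=
  list_prod (flat_map (words m) (seq 0 (S c))) [true; false].

Lemma in_specs (m c : nat) (s : comm_spec) :
  word_in m (fst s) -> weight s <= c -> In s (specs m c).
Proof.
  intros Hw Hc. destruct s as [w b]. apply in_prod.
  - apply in_flat_map. exists (length w). split; [|now apply in_words].
    apply in_seq. unfold weight in Hc; cbn in *; lia.
  - destruct b; cbn; auto.
Qed.

Fixpoint sublists {A : Type} (l : list A) : list (list A) :=
  match l with
  | [] => [[]]
  | x :: l => sublists l ++ map (cons x) (sublists l)
  end.

Lemma filter_sublists {A : Type} (p : A -> bool) (l : list A) :
  In (filter p l) (sublists l).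
Proof.
  induction l as [|x l IH]; cbn; [auto|]. apply in_app_iff.
  destruct (p x); [right; now apply in_map|now left].
Qed.

(** Excluded middle decides for each entry of [T] whether it has a witness; one is fixed where it
    does, and [K] is their maximum. This gives uniform constants without computing them. *)
Lemma finite_bound {X : Type} (T : list X) (R : X -> nat -> Prop) :
  exists K, forall t n, In t T -> R t n -> exists n', n' <= K /\ R t n'.
Proof.
  induction T as [|x T (K & HK)].
  - exists 0. intros t n [].
  - destruct (classic (exists n, R x n)) as [(n0 & Hn0)|Hx].
    + exists (Nat.max K n0). intros t n [<-|Ht] Hn.
      * exists n0; split; [lia|assumption].
      * destruct (HK t n Ht Hn) as (n' & Hn' & HR). exists n'; split; [lia|assumption].
    + exists K. intros t n [<-|Ht] Hn; [exfalso; eauto|eauto].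
Qed.

Definition vars (w : list letter) : list nat := map fst w.

Lemma word_in_compress (vs : list nat) (m : nat) (s : comm_spec) :
  length vs <= m -> supported vs s = true -> word_in m (fst (compress vs s)).
Proof.
  intros Hm Hs. cbn. apply Forall_map, Forall_forall. intros l Hl; cbn.
  pose proof (index_lt vs (fst l) (proj1 (supported_In vs s) Hs l Hl)). lia.
Qed.

Lemma admissible_expand (c r m k : nat) (vs : list nat) (s : comm_spec) :
  1 <= r -> Forall (fun v => v < r) vs ->
  admissible c m k s -> admissible c r k (expand_spec vs s).
Proof.
  intros Hr Hvs [Hk _]. split; [now unfold expand_spec; rewrite weight_rename|].
  cbn. apply Forall_map, Forall_forall. intros l _; cbn.
  (* A number beyond the end of [vs] is sent to the default generator 0, which is legal because
     [1 <= r]. *)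
  destruct (nth_in_or_default (fst l) vs 0) as [H| ->]; [|lia].
  exact (proj1 (Forall_forall _ _) Hvs _ H).
Qed.

Lemma word_in_vars (r : nat) (w : list letter) :
  word_in r w -> Forall (fun v => v < r) (vars w).
Proof. intros H. apply Forall_map. exact H. Qed.

(** Here [us = su [u, s]], and [[u, s]] has some expansion [M] by [generated_comm]. Compressing to
    [2 * c] generators makes [u] and [s] entries of a finite table; the short expansion found there
    is renamed back. *)
Lemma commutator_bound (c : nat) :
  exists K, forall r k u s, 1 <= r -> 1 <= k ->
  admissible c r k u -> admissible c r 1 s ->
  exists M, length M <= K /\ Forall (admissible c r (S k)) M /\
    equiv c [u; s] ([s; u] ++ M).
Proof.
  destruct (finite_bound
    (list_prod (seq 0 (S c)) (list_prod (specs (2 * c) c) (specs (2 * c) c)))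
    (fun t n => let '(k, (u, s)) := t in exists M, length M = n /\
       Forall (admissible c (2 * c) (S k)) M /\ equiv c [u; s] ([s; u] ++ M)))
    as (K & HK).
  exists K. intros r k u s Hr Hk Hu Hs.
  set (vs := vars (fst u ++ fst s)).
  assert (Hlen : length vs <= 2 * c).
  { unfold vs, vars. rewrite length_map, length_app.
    destruct Hu as [Hu _], Hs as [Hs _]. unfold weight in *. lia. }
  assert (Su : supported vs u = true).
  { apply supported_In. intros l Hl. apply in_map, in_app_iff; auto. }
  assert (Ss : supported vs s = true).
  { apply supported_In. intros l Hl. apply in_map, in_app_iff; auto. }
  pose proof (word_in_compress vs _ u Hlen Su) as Wu.
  pose proof (word_in_compress vs _ s Hlen Ss) as Ws.
  destruct (generated_comm c (2 * c) k (spec_term (compress vs u))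
              (spec_term (compress vs s))) as (M & HM & E).
  { assumption. }
  { apply generated_spec; [|assumption]. unfold compress; rewrite weight_rename. apply Hu. }
  { now apply scoped_spec. }
  destruct (HK (k, (compress vs u, compress vs s)) (length M)) as (n & Hn & M' & HM').
  - apply in_prod; [apply in_seq; destruct Hu; lia|].
    apply in_prod; apply in_specs; try assumption; unfold compress;
      rewrite weight_rename; [apply Hu|apply Hs].
  - exists M. split; [reflexivity|]. split; [assumption|].
    intros G HG f. cbn. rewrite <- E by assumption. rewrite eval_tcomm.
    fold (spec_val G f (compress vs u)) (spec_val G f (compress vs s)). group.
  - destruct HM' as (<- & HM' & E').
    exists (map (expand_spec vs) M'). split; [now rewrite length_map|]. split.
    + apply Forall_map. revert HM'. apply Forall_impl. intros t.
      apply admissible_expand; [assumption|]. apply word_in_vars.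
      apply word_in_app; [apply Hu|apply Hs].
    + apply (equiv_rename c (fun k => nth k vs 0)) in E'.
      rewrite map_app in E'. cbn [map] in E'. fold (expand_spec vs) in E'.
      change (equiv c [expand_spec vs (compress vs u); expand_spec vs (compress vs s)]
        ([expand_spec vs (compress vs s); expand_spec vs (compress vs u)] ++
         map (expand_spec vs) M')) in E'.
      now rewrite !expand_compress in E' by assumption.
Qed.

Definition signed_in (B : list comm_spec) (s : comm_spec) : Prop :=
  In s B \/ In (flip s) B.

(** The generating property of [basis_mod], restated for commutators of weight [i] with explicit
    lists, as yet without any length bound. *)
Definition spans (c r i : nat) (B : list comm_spec) : Prop :=
  Forall (spec_ok r i) B /\
  forall u, spec_ok r i u -> exists L M, Forall (signed_in B) L /\
    Forall (admissible c r (S i)) M /\ equiv c [u] (L ++ M).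

Definition spec_eq_dec (s s' : comm_spec) : {s = s'} + {s <> s'}.
Proof. repeat decide equality. Defined.

(** As [B] may be arbitrarily large, the finite table is indexed by its trace on the generators of
    [u], renamed into [0, ..., c - 1]. *)
Lemma spanning_bound (c : nat) :
  exists K, forall r i B u, 1 <= r -> 1 <= i <= c -> spans c r i B -> spec_ok r i u ->
  exists L M, length L + length M <= K /\ Forall (signed_in B) L /\
    Forall (admissible c r (S i)) M /\ equiv c [u] (L ++ M).
Proof.
  destruct (finite_bound
    (list_prod (seq 0 (S c)) (list_prod (specs c c) (sublists (specs c c))))
    (fun t n => let '(i, (u, S')) := t in exists L M, length L + length M = n /\
       Forall (signed_in S') L /\
       Forall (admissible c c (S i)) M /\ equiv c [u] (L ++ M))) as (K & HK).
  exists K. intros r i B u Hr Hi [HB Hspan] Hu.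
  destruct (Hspan u Hu) as (L & M & HL & HM & E). destruct Hu as [Hlu Hwu].
  change (weight u = i) in Hlu.
  set (vs := vars (fst u)).
  assert (Hlen : length vs <= c).
  { replace (length vs) with (weight u) by (symmetry; apply length_map). lia. }
  assert (Su : supported vs u = true).
  { apply supported_In. intros l Hl. now apply in_map. }
  pose proof (word_in_compress vs _ u Hlen Su) as Wu.
  (* The trace of [B]. Being a filter of a fixed list, it is one of the finitely many [sublists]. *)
  set (S' := filter (fun s => if in_dec spec_eq_dec (expand_spec vs s) B then true else false)
               (specs c c)).
  (* Erasing the generators outside [vs] keeps [u] and leaves a decomposition of its compressed form
     over [S'], which shows that the table entry has a witness. *)
  apply (equiv_compress c vs) in E. rewrite filter_app, map_app in E.
  cbn [filter map] in E. rewrite Su in E. cbn [map] in E.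
  destruct (HK (i, (compress vs u, S'))
    (length (map (compress vs) (filter (supported vs) L)) +
     length (map (compress vs) (filter (supported vs) M)))) as (n & Hn & L' & M' & HLM).
  - apply in_prod; [apply in_seq; lia|]. apply in_prod; [|apply filter_sublists].
    apply in_specs; [assumption|]. unfold compress; rewrite weight_rename.
    lia.
  - assert (HS : forall s, supported vs s = true -> In s B -> In (compress vs s) S').
    { intros s Hs Hsb. unfold S'. apply filter_In. split.
      - apply in_specs; [now apply word_in_compress|]. unfold compress; rewrite weight_rename.
        apply (proj1 (Forall_forall _ _) HB) in Hsb. destruct Hsb as [Hsb _]. change (weight s = i) in Hsb. lia.
      - rewrite expand_compress by assumption. now destruct in_dec. }
    do 2 eexists; split; [reflexivity|]. split; [|split; [|exact E]].
    + apply Forall_map, Forall_forall. intros s Hs. apply filter_In in Hs.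
      destruct Hs as [Hs Hsup]. apply (proj1 (Forall_forall _ _) HL) in Hs.
      destruct Hs as [Hs|Hs]; [left|right].
      * now apply HS.
      * apply (HS (flip s)); assumption.
    + apply Forall_map, Forall_forall. intros s Hs. apply filter_In in Hs.
      destruct Hs as [Hs Hsup]. apply (proj1 (Forall_forall _ _) HM) in Hs.
      destruct Hs as [Hw _]. split; [now unfold compress; rewrite weight_rename|].
      now apply word_in_compress.
  - destruct HLM as (<- & HL' & HM' & E').
    exists (map (expand_spec vs) L'), (map (expand_spec vs) M').
    rewrite !length_map. split; [assumption|].
    assert (HS : forall s, In s S' -> In (expand_spec vs s) B).
    { intros s Hs. apply filter_In in Hs. destruct Hs as [_ Hs]. now destruct in_dec. }
    split; [|split].
    + apply Forall_map. revert HL'. apply Forall_impl. intros s [Hs|Hs]; [left|right].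
      * now apply HS.
      * now apply (HS (flip s)).
    + apply Forall_map. revert HM'. apply Forall_impl. intros s.
      apply admissible_expand; [assumption|]. now apply word_in_vars.
    + apply (equiv_rename c (fun k => nth k vs 0)) in E'. rewrite map_app in E'.
      change (equiv c [expand_spec vs (compress vs u)]
        (map (expand_spec vs) L' ++ map (expand_spec vs) M')) in E'.
      now rewrite expand_compress in E' by assumption.
Qed.

(** * Powers of basis elements *)

(** Exponents are written out as repetitions, so that the length of a list is the sum of the
    absolute values of its exponents. *)
Definition power (b : comm_spec) (a : Z) : list comm_spec :=
  repeat (if (0 <=? a)%Z then b else flip b) (Z.abs_nat a).

Definition powers (B : list comm_spec) (alpha : list Z) : list comm_spec :=
  flat_map (fun p => power (fst p) (snd p)) (combine B alpha).

Lemma spec_prod_power (G : Group) (f : nat -> G) (b : comm_spec) (a : Z) :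
  spec_prod G f (power b a) = eval G f (tpow (spec_term b) a).
Proof.
  assert (E : forall n, spec_prod G f (repeat b n) = eval G f (tpowN (spec_term b) n)).
  { induction n as [|n IH]; cbn; [reflexivity|]. now rewrite IH. }
  unfold power, tpow. destruct (Z.leb_spec 0 a) as [Ha|Ha].
  - rewrite E. now rewrite Zabs2Nat.abs_nat_nonneg.
  - cbn [eval]. rewrite <- E, <- spec_prod_inv, map_repeat, rev_repeat.
    now replace (Z.abs_nat a) with (Z.to_nat (- a)) by lia.
Qed.

Lemma spec_prod_powers (G : Group) (f : nat -> G) (B : list comm_spec) (alpha : list Z) :
  spec_prod G f (powers B alpha) = eval G f (prod_pow (map spec_term B) alpha).
Proof.
  revert alpha; induction B as [|b B IH]; intros [|a alpha]; try reflexivity.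
  change (powers (b :: B) (a :: alpha)) with (power b a ++ powers B alpha).
  rewrite spec_prod_app, spec_prod_power, IH. reflexivity.
Qed.

Lemma power_nat (b : comm_spec) (n : nat) : power b (Z.of_nat n) = repeat b n.
Proof.
  unfold power. rewrite Zabs2Nat.id. destruct (Z.leb_spec 0 (Z.of_nat n)); [reflexivity|lia].
Qed.

Lemma power_opp_nat (b : comm_spec) (n : nat) :
  power b (- Z.of_nat n) = repeat (flip b) n.
Proof.
  unfold power. replace (Z.abs_nat (- Z.of_nat n)) with n by lia.
  destruct n as [|n]; [reflexivity|].
  destruct (Z.leb_spec 0 (- Z.of_nat (S n))); [lia|reflexivity].
Qed.

Lemma length_power (b : comm_spec) (a : Z) : length (power b a) = Z.abs_nat a.
Proof. apply repeat_length. Qed.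

Lemma equiv_flip_l (c : nat) (b : comm_spec) (L : list comm_spec) :
  equiv c (flip b :: b :: L) L.
Proof. intros G HG f; cbn. rewrite spec_val_flip. group. Qed.

Lemma equiv_flip_r (c : nat) (b : comm_spec) (L : list comm_spec) :
  equiv c (b :: flip b :: L) L.
Proof. intros G HG f; cbn. rewrite spec_val_flip. group. Qed.

Lemma power_absorb (c : nat) (b u : comm_spec) (a : Z) :
  u = b \/ flip u = b ->
  exists a', equiv c (u :: power b a) (power b a') /\
    length (power b a') <= S (length (power b a)).
Proof.
  intros Hu.
  assert (Ha : exists n, a = Z.of_nat n \/ a = (- Z.of_nat n)%Z)
    by (exists (Z.abs_nat a); lia).
  assert (Hb : u = b \/ u = flip b).
  { destruct Hu as [Hu|Hu]; [now left|right]. now rewrite <- Hu, flip_flip. }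
  destruct Ha as (n & [-> | ->]), Hb as [-> | ->].
  - exists (Z.of_nat (S n)). rewrite !power_nat. split; [reflexivity|cbn; lia].
  (* Exponent zero is separate: prepending the inverse of [b] there lengthens the power instead of
     cancelling a factor. *)
  - destruct n as [|n].
    + exists (- Z.of_nat 1)%Z. rewrite power_nat, power_opp_nat. split; [reflexivity|cbn; lia].
    + exists (Z.of_nat n). rewrite !power_nat. split; [apply equiv_flip_l|cbn; lia].
  - destruct n as [|n].
    + exists (Z.of_nat 1). rewrite power_nat, power_opp_nat. split; [reflexivity|cbn; lia].
    + exists (- Z.of_nat n)%Z. rewrite !power_opp_nat. split; [apply equiv_flip_r|cbn; lia].
  - exists (- Z.of_nat (S n))%Z. rewrite !power_opp_nat. split; [reflexivity|cbn; lia].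
Qed.

Lemma in_power (b s : comm_spec) (a : Z) : In s (power b a) -> s = b \/ s = flip b.
Proof.
  intros H. apply repeat_spec in H. destruct (0 <=? a)%Z; auto.
Qed.

Lemma in_powers (B : list comm_spec) (alpha : list Z) (s : comm_spec) :
  In s (powers B alpha) -> signed_in B s.
Proof.
  intros H. apply in_flat_map in H. destruct H as ([b a] & Hb & Hs).
  apply in_combine_l in Hb. apply in_power in Hs. cbn in Hs.
  destruct Hs as [-> | ->]; [now left|right]. now rewrite flip_flip.
Qed.

Lemma powers_app (B B' : list comm_spec) (alpha alpha' : list Z) :
  length alpha = length B ->
  powers (B ++ B') (alpha ++ alpha') = powers B alpha ++ powers B' alpha'.
Proof.
  revert alpha; induction B as [|b B IH]; intros [|a alpha] H; try discriminate;
    [reflexivity|].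
  injection H as H. unfold powers in *; cbn. now rewrite IH, app_assoc.
Qed.

Lemma powers_bound (B : list comm_spec) (alpha : list Z) :
  length alpha = length B ->
  Forall (fun a => Z.abs_nat a <= length (powers B alpha)) alpha.
Proof.
  revert alpha; induction B as [|b B IH]; intros [|a alpha] H; try discriminate;
    [constructor|]. injection H as H.
  change (powers (b :: B) (a :: alpha)) with (power b a ++ powers B alpha).
  rewrite length_app, length_power. constructor; [lia|].
  eapply Forall_impl; [|apply IH, H]. cbn; intros; lia.
Qed.

(** * Collection *)

(** Each of at most [N] entries crossed creates at most [K] heavier commutators, and each of these,
    pushed past the rest in turn, becomes at most [1 + push_bound K N d] entries. *)
Fixpoint push_bound (K N d : nat) : nat :=
  match d with 0 => 0 | S d => N * K * (1 + push_bound K N d) end.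

(** Bounds the entries left, itself included, by one entry moved past a list of length at most
    [N]. *)
Definition sort_factor (K c N : nat) : nat := 1 + push_bound K N c.

(** [J * N] bounds the powers of the current block; the recursive argument bounds the heavier
    remainder handed to the next block. *)
Fixpoint collect_bound (K J c d N : nat) : nat :=
  match d with
  | 0 => 0
  | S d => J * N + collect_bound K J c d
                     (J * N * (sort_factor K c (J * N) * sort_factor K c (J * N)))
  end.

Section Collection.
Variables c r K J : nat.
Hypothesis HK : forall k u s, 1 <= k ->
  admissible c r k u -> admissible c r 1 s ->
  exists M, length M <= K /\ Forall (admissible c r (S k)) M /\
    equiv c [u; s] ([s; u] ++ M).
Hypothesis HJ : forall i B u, 1 <= i <= c -> spans c r i B -> spec_ok r i u ->
  exists L M, length L + length M <= J /\ Forall (signed_in B) L /\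
    Forall (admissible c r (S i)) M /\ equiv c [u] (L ++ M).
Hypothesis HJ1 : 1 <= J.

Lemma push_list (k b : nat) (sigma : list comm_spec) :
  (forall u, admissible c r k u ->
     exists H, Forall (admissible c r (S k)) H /\ length H <= b /\
       equiv c (u :: sigma) (sigma ++ u :: H)) ->
  forall V, Forall (admissible c r k) V ->
  exists V', Forall (admissible c r k) V' /\ length V' <= length V * (1 + b) /\
    equiv c (V ++ sigma) (sigma ++ V').
Proof.
  intros Hpush V HV. induction HV as [|u V Hu HV IH].
  - exists []. rewrite app_nil_r. repeat split; [constructor|cbn; lia].
  - destruct IH as (V' & HV' & Hl & E), (Hpush u Hu) as (H & HH & Hb & EH).
    exists (u :: H ++ V'). split; [|split].
    + constructor; [assumption|]. apply Forall_app; split; [|assumption].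
      now apply (Forall_admissible_le c r (S k)); [lia|].
    + cbn. rewrite length_app. nia.
    + cbn [app]. rewrite E. change (u :: sigma ++ V') with ((u :: sigma) ++ V').
      rewrite EH, <- app_assoc. reflexivity.
Qed.

(* The recursion is on the weight, from the top: [d] bounds [c + 1 - k]. *)
Lemma push (N d : nat) : forall k u sigma, 1 <= k -> c < k + d ->
  admissible c r k u -> Forall (admissible c r 1) sigma -> length sigma <= N ->
  exists H, Forall (admissible c r (S k)) H /\ length H <= push_bound K N d /\
    equiv c (u :: sigma) (sigma ++ u :: H).
Proof.
  induction d as [|d IHd]; intros k u sigma Hk Hd Hu Hs HN.
  - destruct Hu as [Hu _]; lia.
  (* The induction on [sigma] needs a bound proportional to [length sigma]; the bound with [N]
     follows from it. *)
  - cut (exists H, Forall (admissible c r (S k)) H /\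
           length H <= length sigma * K * (1 + push_bound K N d) /\
           equiv c (u :: sigma) (sigma ++ u :: H)).
    { intros (H & HH & Hl & E). exists H. split; [assumption|]. split; [|assumption].
      etransitivity; [exact Hl|]. cbn [push_bound]. now do 2 apply Nat.mul_le_mono_r. }
    induction Hs as [|s sigma Hs Hsigma IH].
    + exists []. repeat split; [constructor|cbn; lia].
    + cbn in HN. destruct IH as (H & HH & Hl & E); [lia|].
      destruct (HK k u s Hk Hu Hs) as (M & HM & HMa & EM).
      (* In [u s sigma = s u M sigma], the heavier [M] crosses [sigma] by induction on [d], and [u]
         crosses it by induction on [sigma]. *)
      destruct (push_list (S k) (push_bound K N d) sigma) with (V := M)
        as (M' & HM' & Hl' & E').
      { intros v Hv. apply IHd; try assumption; lia. }
      { assumption. }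
      exists (H ++ M'). split; [now apply Forall_app|]. split.
      * rewrite length_app. cbn [length]. nia.
      * change (u :: s :: sigma) with ([u; s] ++ sigma). rewrite EM, <- app_assoc, E'.
        change (equiv c (s :: (u :: sigma) ++ M') (s :: sigma ++ u :: H ++ M')).
        rewrite E, <- app_assoc. reflexivity.
Qed.

Lemma signed_admissible (k : nat) (B : list comm_spec) (s : comm_spec) :
  Forall (admissible c r k) B -> signed_in B s -> admissible c r k s.
Proof.
  intros HB [H|H]; apply (proj1 (Forall_forall _ _) HB) in H; assumption.
Qed.

(** Entries are inserted from the right end of [v] into an already collected product. Its power part
    is never longer than the entries inserted so far, so [push] applies with the same [N]
    throughout. The factor is squared because the commutators created by one crossing may have to
    cross the remaining powers. *)
Lemma collect_weight (i N : nat) (B v : list comm_spec) :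
  1 <= i -> Forall (admissible c r i) B ->
  Forall (fun s => signed_in B s \/ admissible c r (S i) s) v -> length v <= N ->
  exists alpha h, length alpha = length B /\
    length (powers B alpha) <= length v /\
    Forall (admissible c r (S i)) h /\
    length h <= length v * (sort_factor K c N * sort_factor K c N) /\
    equiv c v (powers B alpha ++ h).
Proof.
  intros Hi HB Hv. unfold sort_factor. set (b := push_bound K N c).
  induction Hv as [|u v Hu Hv IH]; intros HN.
  - exists (repeat 0%Z (length B)), [].
    assert (E : powers B (repeat 0%Z (length B)) = []).
    { clear. induction B; cbn; auto. }
    rewrite E, repeat_length. repeat split; [cbn; lia|constructor|cbn; lia].
  - cbn in HN. destruct IH as (alpha & h & Hal & Hp & Hh & Hlh & E); [lia|].
    assert (HP : Forall (admissible c r 1) (powers B alpha)).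
    { apply Forall_forall. intros s Hs. apply in_powers in Hs.
      apply (admissible_le c r i); [assumption|]. now apply (signed_admissible i B). }
    destruct Hu as [Hu|Hu].
    + assert (exists b0, In b0 B /\ (u = b0 \/ flip u = b0)) as (b0 & Hb0 & Hub)
        by (destruct Hu; eauto).
      assert (Hui : admissible c r i u) by now apply (signed_admissible i B).
      apply in_split in Hb0. destruct Hb0 as (B1 & B2 & ->).
      rewrite length_app in Hal. cbn in Hal.
      (* The entry [u] is [b0] or its inverse. It crosses the powers of [B1], the commutators
         created then cross everything from the power of [b0] on, and [u] is left adjacent to that
         power. *)
      assert (exists a1 a a2, alpha = a1 ++ a :: a2 /\ length a1 = length B1)
        as (a1 & a & a2 & -> & Ha1).
      { pose proof (firstn_skipn (length B1) alpha) as Hf.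
        destruct (skipn (length B1) alpha) as [|a a2] eqn:Hsk.
        - apply (f_equal (@length Z)) in Hsk. rewrite length_skipn in Hsk. cbn in Hsk. lia.
        - exists (firstn (length B1) alpha), a, a2. split; [congruence|].
          rewrite length_firstn. lia. }
      assert (EP : forall x, powers (B1 ++ b0 :: B2) (a1 ++ x :: a2) =
                  powers B1 a1 ++ power b0 x ++ powers B2 a2).
      { intros x. now rewrite powers_app. }
      rewrite EP in *. rewrite !length_app in Hp.
      apply Forall_app in HP. destruct HP as [HP1 HP2].
      destruct (push N c i u (powers B1 a1)) as (H & HH & HHl & EH);
        try assumption; [lia|lia|].
      destruct (push_list (S i) b (power b0 a ++ powers B2 a2)) with (V := H)
        as (H' & HH' & HHl' & EH').
      { intros x Hx. apply push; try assumption; [lia|lia|]. rewrite length_app. lia. }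
      { assumption. }
      destruct (power_absorb c b0 u a Hub) as (a' & Ea & Hla).
      exists (a1 ++ a' :: a2), (H' ++ h).
      rewrite EP. rewrite !length_app in *. cbn [length] in *.
      split; [lia|]. split; [lia|]. split; [now apply Forall_app|].
      fold b in HHl. split; [nia|].
      rewrite E, <- !app_assoc.
      change (u :: powers B1 a1 ++ power b0 a ++ powers B2 a2 ++ h) with
        ((u :: powers B1 a1) ++ power b0 a ++ powers B2 a2 ++ h).
      rewrite EH, <- app_assoc. cbn [app].
      replace (H ++ power b0 a ++ powers B2 a2 ++ h) with
        ((H ++ power b0 a ++ powers B2 a2) ++ h) by now rewrite <- !app_assoc.
      rewrite EH', <- !app_assoc.
      change (u :: power b0 a ++ powers B2 a2 ++ H' ++ h) with
        ((u :: power b0 a) ++ powers B2 a2 ++ H' ++ h).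
      now rewrite Ea.
    + destruct (push N c (S i) u (powers B alpha)) as (H & HH & HHl & EH);
        try assumption; [lia|lia|lia|].
      exists alpha, (u :: H ++ h). fold b in HHl.
      split; [assumption|]. split; [cbn; lia|]. split.
      { constructor; [assumption|]. apply Forall_app; split; [|assumption].
        now apply (Forall_admissible_le c r (S (S i))); [lia|]. }
      split; [cbn [length]; rewrite length_app; nia|].
      rewrite E. change (u :: powers B alpha ++ h) with ((u :: powers B alpha) ++ h).
      rewrite EH, <- app_assoc. reflexivity.
Qed.

(** Entries of weight exactly [i] are expanded through the basis; heavier ones are kept, which the
    factor [J] covers because [1 <= J]. *)
Lemma rewrite_in_basis (i : nat) (B v : list comm_spec) :
  1 <= i <= c -> spans c r i B -> Forall (admissible c r i) v ->
  exists v', Forall (fun s => signed_in B s \/ admissible c r (S i) s) v' /\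
    length v' <= J * length v /\ equiv c v v'.
Proof.
  intros Hi HB Hv. induction Hv as [|u v Hu Hv IH].
  - exists []. split; [constructor|]. split; [cbn; lia|reflexivity].
  - destruct IH as (v' & Hv' & Hl & E). destruct Hu as [Hw Hu].
    destruct (Nat.eq_dec (weight u) i) as [Hui|Hui].
    + destruct (HJ i B u Hi HB) as (L & M & HLM & HL & HM & EU); [now split|].
      exists ((L ++ M) ++ v'). split; [|split].
      * apply Forall_app; split; [|assumption]. apply Forall_app; split.
        -- revert HL; apply Forall_impl; auto.
        -- revert HM; apply Forall_impl; auto.
      * rewrite !length_app. cbn [length]. nia.
      * change (u :: v) with ([u] ++ v). now rewrite EU, E.
    + exists (u :: v'). split; [|split].
      * constructor; [|assumption]. right. split; [lia|assumption].
      * cbn [length]. nia.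
      * now rewrite E.
Qed.

Fixpoint spanning_blocks (i : nat) (Y : list (list comm_spec)) : Prop :=
  match Y with
  | [] => True
  | B :: Y => spans c r i B /\ spanning_blocks (S i) Y
  end.

Lemma collect (Y : list (list comm_spec)) : forall i v N,
  1 <= i -> i + length Y = S c -> spanning_blocks i Y ->
  Forall (admissible c r i) v -> length v <= N ->
  exists alpha, length alpha = length (concat Y) /\
    equiv c v (powers (concat Y) alpha) /\
    length (powers (concat Y) alpha) <= collect_bound K J c (length Y) N.
Proof.
  induction Y as [|B Y IH]; intros i v N Hi Hic HY Hv HN.
  - exists []. split; [reflexivity|]. split; [|cbn; lia].
    (* With no block left, [i] is [S c], and no admissible commutator has that weight, so [v] is
       empty. *)
    destruct Hv as [|u v [Hu _] _]; [reflexivity|]. cbn in Hic. lia.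
  - cbn in Hic. destruct HY as [HB HY].
    destruct (rewrite_in_basis i B v) as (v1 & Hv1 & Hl1 & E1); [lia|assumption..|].
    destruct (collect_weight i (J * N) B v1) as (alpha & h & Hal & Hp & Hh & Hlh & E2);
      [assumption| |assumption|nia|].
    { destruct HB as [HB _]. revert HB. apply Forall_impl. intros s [Hs Hw].
      split; [|assumption]. unfold weight; rewrite Hs; lia. }
    set (N' := J * N * (sort_factor K c (J * N) * sort_factor K c (J * N))).
    destruct (IH (S i) h N') as (alpha' & Hal' & E3 & Hp');
      [lia|lia|assumption|assumption| |].
    { etransitivity; [exact Hlh|]. apply Nat.mul_le_mono_r. nia. }
    exists (alpha ++ alpha'). cbn [concat]. rewrite powers_app by assumption.
    rewrite !length_app. split; [lia|]. split.
    + now rewrite E1, E2, E3.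
    + cbn [length collect_bound]. fold N'. nia.
Qed.
End Collection.

(** * Blocks of a Malcev basis *)

(** The first letter lies at index 1 and every further letter raises the index by one. *)
Lemma in_gamma_spec (r c i : nat) (s : comm_spec) :
  1 <= i -> spec_ok r i s -> in_gamma r c i (spec_term s).
Proof.
  destruct s as [[|l ls] b]; intros Hi [Hl Hw]; cbn in Hl, Hw; [lia|].
  inversion_clear Hw as [|x y Hl0 Hls].
  assert (H : forall k a, in_gamma r c k a ->
            in_gamma r c (length ls + k) (tlcomm a (map letter_term ls))).
  { clear - Hls. induction Hls as [|x ls Hx Hls IH]; intros k a Ha; [assumption|].
    cbn. rewrite <- Nat.add_succ_r. apply (IH (S k)).
    constructor; [assumption|]. now apply scoped_letter. }
  specialize (H 1 (letter_term l)). rewrite Nat.add_1_r, Hl in H.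
  assert (in_gamma r c i (tlcomm (letter_term l) (map letter_term ls))).
  { apply H. constructor. now apply scoped_letter. }
  destruct b; cbn; [assumption|now constructor].
Qed.

(** The quotient of [u] by its basis expression lies in the next term of the series, so
    [generated_gamma] writes it as a product of heavier commutators. *)
Lemma spans_basis (r c i : nat) (B : list comm_spec) :
  1 <= i -> Forall (spec_ok r i) B -> basis_mod r c i (map spec_term B) ->
  spans c r i B.
Proof.
  intros Hi HB [Hb _]. split; [assumption|]. intros u Hu.
  destruct (Hb (spec_term u)) as (es & _ & Hes); [now apply in_gamma_spec|].
  apply generated_gamma in Hes; [|lia]. destruct Hes as (M & HM & E).
  exists (powers B es), M. split; [|split; [assumption|]].
  - apply Forall_forall. intros s. apply in_powers.
  - intros G HG f. rewrite spec_prod_app, spec_prod_powers, <- E by assumption. cbn.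
    change (spec_val G f u) with (eval G f (spec_term u)). group.
Qed.

Lemma spans_generators (r c : nat) :
  spans c r 1 (map (fun k => ([(k, true)], true)) (seq 0 r)).
Proof.
  split.
  - apply Forall_map, Forall_forall. intros k Hk. apply in_seq in Hk.
    split; [reflexivity|]. repeat constructor; cbn; lia.
  - intros [w s] [Hl Hw]; cbn in Hl, Hw.
    destruct w as [|[k d] [|? ?]]; try discriminate. inversion_clear Hw as [|x y Hk _].
    (* In weight 1 the sign of the letter and the outer sign multiply, and nothing heavier
       appears. *)
    exists [([(k, true)], Bool.eqb d s)], []. split; [|split; [constructor|]].
    + assert (Hin : In ([(k, true)], true)
                       (map (fun k => ([(k, true)], true)) (seq 0 r))).
      { apply (in_map (fun k => ([(k, true)], true))), in_seq. cbn in Hk; lia. }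
      constructor; [|constructor]. destruct (Bool.eqb d s); [now left|now right].
    + intros G HG f; destruct d, s; unfold spec_prod, spec_val; cbn; group.
Qed.

Lemma spanning_blocks_Malcev (r c : nat) (Y : list (list comm_spec)) :
  1 <= c -> MalcevBasis r c Y -> spanning_blocks c r 1 Y.
Proof.
  intros Hc (Hlen & H1 & H2).
  assert (H : forall i, i < length Y -> spans c r (S i) (nth i Y [])).
  { intros [|i] Hi; [rewrite H1; apply spans_generators|].
    destruct (H2 (S (S i))) as [Hok Hb]; [lia|]. now apply spans_basis; [lia| |]. }
  clear H1 H2 Hlen.
  (* The starting weight is generalised to [j] for the induction on the list of blocks. *)
  assert (Hgen : forall Y' j, (forall i, i < length Y' -> spans c r (j + i) (nth i Y' [])) ->
                   spanning_blocks c r j Y').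
  { induction Y' as [|B Y' IH]; intros j Hj; cbn; [trivial|]. split.
    - rewrite <- (Nat.add_0_r j). apply (Hj 0). cbn; lia.
    - apply IH. intros i Hi. rewrite Nat.add_succ_comm. apply (Hj (S i)). cbn; lia. }
  apply Hgen. exact H.
Qed.

(** * Polynomial growth *)

(** The base [n + 1] is positive, which makes its powers monotone in the exponent even at
    [n = 0]. *)
Definition poly_bounded (f : nat -> nat) : Prop :=
  exists C D, forall n, f n <= C * (n + 1) ^ D.

Lemma poly_bounded_const (a : nat) : poly_bounded (fun _ => a).
Proof. exists a, 0. intros n; cbn; lia. Qed.

Lemma poly_bounded_id : poly_bounded (fun n => n).
Proof. exists 1, 1. intros n; cbn; lia. Qed.

Lemma poly_bounded_add (f g : nat -> nat) :
  poly_bounded f -> poly_bounded g -> poly_bounded (fun n => f n + g n).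
Proof.
  intros (C & D & Hf) (C' & D' & Hg). exists (C + C'), (D + D'). intros n.
  specialize (Hf n); specialize (Hg n).
  assert ((n + 1) ^ D <= (n + 1) ^ (D + D')) by (apply Nat.pow_le_mono_r; lia).
  assert ((n + 1) ^ D' <= (n + 1) ^ (D + D')) by (apply Nat.pow_le_mono_r; lia).
  nia.
Qed.

Lemma poly_bounded_mul (f g : nat -> nat) :
  poly_bounded f -> poly_bounded g -> poly_bounded (fun n => f n * g n).
Proof.
  intros (C & D & Hf) (C' & D' & Hg). exists (C * C'), (D + D'). intros n.
  rewrite Nat.pow_add_r.
  replace (C * C' * ((n + 1) ^ D * (n + 1) ^ D'))
    with (C * (n + 1) ^ D * (C' * (n + 1) ^ D')) by ring.
  now apply Nat.mul_le_mono.
Qed.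

Lemma poly_bounded_comp (f g : nat -> nat) :
  poly_bounded f -> poly_bounded g -> poly_bounded (fun n => f (g n)).
Proof.
  intros (C & D & Hf) Hg.
  assert (H : poly_bounded (fun n => C * (g n + 1) ^ D)).
  { apply poly_bounded_mul; [apply poly_bounded_const|].
    clear Hf. induction D as [|D IH]; [exact (poly_bounded_const 1)|]. cbn.
    apply poly_bounded_mul; [|exact IH].
    apply poly_bounded_add; [exact Hg|apply poly_bounded_const]. }
  destruct H as (C' & D' & H). exists C', D'. intros n.
  etransitivity; [apply Hf|apply H].
Qed.

(** The recursions run over [c] and [d], which stay fixed while [N] varies, so only boundedly many
    sums, products and compositions occur. *)
Lemma poly_bounded_collect (K J c d : nat) : poly_bounded (collect_bound K J c d).
Proof.
  assert (HS : poly_bounded (sort_factor K c)).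
  { unfold sort_factor. apply poly_bounded_add; [apply poly_bounded_const|].
    induction c as [|e IH]; cbn [push_bound]; [apply poly_bounded_const|].
    apply poly_bounded_mul.
    - apply poly_bounded_mul; [apply poly_bounded_id|apply poly_bounded_const].
    - apply poly_bounded_add; [apply poly_bounded_const|exact IH]. }
  assert (HJ : poly_bounded (fun n => J * n))
    by (apply poly_bounded_mul; [apply poly_bounded_const|apply poly_bounded_id]).
  induction d as [|d IH]; cbn [collect_bound]; [exact (poly_bounded_const 0)|].
  apply poly_bounded_add; [exact HJ|].
  apply (poly_bounded_comp _ (fun N => J * N *
           (sort_factor K c (J * N) * sort_factor K c (J * N))) IH).
  apply poly_bounded_mul; [exact HJ|].
  apply poly_bounded_mul; now apply (poly_bounded_comp _ (fun n => J * n)).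
Qed.

Fixpoint padd (p q : list Z) : list Z :=
  match p, q with
  | [], _ => q
  | _, [] => p
  | a :: p, b :: q => (a + b)%Z :: padd p q
  end.

Lemma peval_padd (p q : list Z) (x : Z) : peval (padd p q) x = (peval p x + peval q x)%Z.
Proof.
  revert q; induction p as [|a p IH]; intros [|b q]; cbn; [lia..|].
  unfold peval in IH. rewrite IH. ring.
Qed.

Lemma poly_bounded_peval (f : nat -> nat) :
  poly_bounded f -> exists P, forall n, (Z.of_nat (f n) <= peval P (Z.of_nat n))%Z.
Proof.
  intros (C & D & Hf).
  assert (exists P, forall n, peval P (Z.of_nat n) = Z.of_nat (C * (n + 1) ^ D)) as (P & HP).
  { clear. induction D as [|D (P & HP)].
    - exists [Z.of_nat C]. intros n; cbn. lia.
    (* Multiplication by [n + 1] adds to the coefficient list its own shift. *)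
    - exists (padd P (0%Z :: P)). intros n. rewrite peval_padd.
      change (peval (0%Z :: P) (Z.of_nat n)) with (0 + Z.of_nat n * peval P (Z.of_nat n))%Z.
      rewrite HP, Nat.pow_succ_r'. nia. }
  exists P. intros n. rewrite HP. apply Nat2Z.inj_le, Hf.
Qed.

(** * From words to the exponent bound *)

Lemma spec_prod_word (G : Group) (f : nat -> G) (w : list letter) :
  spec_prod G f (map (fun l => ([l], true)) w) = eval G f (word_term w).
Proof. induction w as [|l w IH]; cbn; [reflexivity|]. now rewrite IH. Qed.

Theorem mainTheorem1 :
  forall c : nat, (1 <= c)%nat ->
  exists P : list Z,
  forall (r : nat) (Y : list (list comm_spec)) (w : list letter),
    (1 <= r)%nat -> MalcevBasis r c Y -> word_in r w ->
    exists alpha : list Z,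
      length alpha = length (malcev_terms Y) /\
      Neq c (word_term w) (prod_pow (malcev_terms Y) alpha) /\
      Forall (fun a => (Z.abs a <= peval P (Z.of_nat (length w)))%Z) alpha.
Proof.
  intros c Hc.
  destruct (commutator_bound c) as (K & HK), (spanning_bound c) as (J & HJ).
  (* [S J] replaces [J] so that the constant is at least 1; the last [c] is the number of blocks.
     Neither [r] nor [Y] has been introduced yet. *)
  destruct (poly_bounded_peval _ (poly_bounded_collect K (S J) c c)) as (P & HP).
  exists P. intros r Y w Hr HY Hw.
  destruct (collect c r K (S J)) with (Y := Y) (i := 1) (N := length w)
    (v := map (fun l : letter => ([l], true)) w) as (alpha & Hal & E & Hb).
  - intros k u s. now apply HK.
  - intros i B u Hi HB Hu. destruct (HJ r i B u Hr Hi HB Hu) as (L & M & HLM & H).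
    exists L, M. split; [lia|exact H].
  - lia.
  - lia.
  - destruct HY as [HY _]. rewrite HY. reflexivity.
  - now apply spanning_blocks_Malcev.
  - apply Forall_map. revert Hw. apply Forall_impl. intros l Hl.
    split; [cbn; lia|]. repeat constructor; assumption.
  - now rewrite length_map.
  - exists alpha. unfold malcev_terms. split; [now rewrite length_map|]. split.
    + intros G HG f. rewrite <- spec_prod_powers, <- spec_prod_word. now apply E.
    (* Each exponent is at most the total length of the collected product, which [collect]
       bounds. *)
    + eapply Forall_impl; [|apply powers_bound, Hal]. cbn. intros a Ha.
      specialize (HP (length w)). destruct HY as [HY _]. rewrite HY in Hb. lia.
Qed.
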